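(* For every $\eta \in (0,1)$ there exists a constant $c_\eta > 0$ depending only on $\eta$ such that, for all integers $n \geq 1$, $p \geq 2$ and all $q_0 \in \Delta_p$ with $q_0(1) \geq q_0(2) \geq \dots \geq q_0(p) \geq 0$, $$\mathcal{R}_{\mathcal{M}}\left(c_\eta\left(\frac{1}{n} + \sqrt{\frac{q_0^{\max}(1-q_0^{\max})}{n}} + \frac{\psi}{n}\right), n, q_0\right) \geq \eta,$$ where $$\psi = \max_{1 \leq j \leq p-1} nq_0^{-\max}(j)\, h^{-1}\left(\frac{\log(ej)}{nq_0^{-\max}(j)}\right).$$
   Context: $\Delta_p = \{\pi \in [0,1]^p : \sum_{j=1}^p \pi(j) = 1\}$. $q_0^{\max} = \max_j q_0(j) = q_0(1)$ and $q_0^{-\max} = (q_0(2),\dots,q_0(p)) \in [0,1]^{p-1}$, so $q_0^{-\max}(j) = q_0(j+1)$. The function $h : [-1,\infty) \to \mathbb{R}$ is defined by $h(-1) = 1$ and $h(x) = (1+x)\log(1+x) - x$ for $x > -1$; $h^{-1} : [0,\infty) \to [0,\infty)$ is the inverse of $h$ restricted to $[0,\infty)$. An expression of the form $x\,h^{-1}(a/x)$ is interpreted as $0$ (its limit) when $x = 0$. For $q \in \Delta_p$, $P_q$ is the law of $X \sim \mathrm{Multinomial}(n,q)$; for $\varepsilon>0$, $\Pi(q_0,\varepsilon) = \{q \in \Delta_p : \|q - q_0\|_\infty \geq \varepsilon\}$ with $\|v\|_\infty = \max_j|v_j|$. The minimax testing risk is $$\mathcal{R}_{\mathcal{M}}(\varepsilon,n,q_0)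 = \inf_\varphi\left\{P_{q_0}\{\varphi = 1\} + \sup_{q \in \Pi(q_0,\varepsilon)} P_q\{\varphi = 0\}\right\},$$ the infimum being over all measurable $\{0,1\}$-valued functions $\varphi = \varphi(X)$. *)

(* Defs.v *)
(* MathComp / MathComp-Analysis *)
From HB Require Import structures.
From mathcomp Require Import all_boot all_order all_algebra.
From mathcomp Require Import all_classical all_reals all_analysis.

Set Implicit Arguments.
Unset Strict Implicit.
Unset Printing Implicit Defensive.

Import Order.TTheory GRing.Theory Num.Theory.
Import numFieldNormedType.Exports.

Local Open Scope classical_set_scope.
Local Open Scope ring_scope.

Definition simplex (R : realType) (p : nat) : set 'rV[R]_p :=
  [set q | (forall j, 0 <= q 0 j <= 1) /\ \sum_(j < p) q 0 j = 1].

(* A multinomial vector of size n has its counts in {0, ..., n}; the law puts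
   no mass on the vectors whose counts do not add up to n. *)
Definition sample (n p : nat) : finType := {ffun 'I_p -> 'I_n.+1}.

Definition multinomial_pmf (R : realType) (n p : nat) (q : 'rV[R]_p)
    (x : sample n p) : R :=
  if (\sum_(j < p) x j)%N == n then
    n`!%:R / (\prod_(j < p) (x j)`!%:R) * \prod_(j < p) q 0 j ^+ x j
  else 0.

Definition multinomial_law (R : realType) (n p : nat) (q : 'rV[R]_p)
    (A : {set sample n p}) : R :=
  \sum_(x in A) multinomial_pmf q x.

(* The library norm of 'rV[R]_p is the sup norm. *)
Definition alternatives (R : realType) (p : nat) (q0 : 'rV[R]_p) (eps : R) :
    set 'rV[R]_p :=
  [set q | simplex q /\ eps <= `|q - q0|].

(* The sample space is finite, so every test is measurable.  All suprema and
   infima are over subsets of [0, 2]; the supremum over an empty set of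
   alternatives is 0. *)
Definition test_risk (R : realType) (eps : R) (n p : nat) (q0 : 'rV[R]_p)
    (phi : sample n p -> bool) : R :=
  multinomial_law q0 [set x | phi x]%SET +
  sup [set multinomial_law q [set x | ~~ phi x]%SET
      | q in alternatives q0 eps].

Definition minimax_risk (R : realType) (eps : R) (n p : nat) (q0 : 'rV[R]_p) :
    R :=
  inf [set test_risk eps q0 phi | phi in [set: sample n p -> bool]].

Definition hfun (R : realType) (x : R) : R :=
  if x == -1 then 1 else (1 + x) * ln (1 + x) - x.

Definition hinv (R : realType) : R -> R := pinv (`[0, +oo[ : set R) (@hfun R).

Definition qmax (R : realType) (p : nat) (q : 'rV[R]_p) : R :=
  \big[Num.max/0]_(j < p) q 0 j.

(* Coordinates are numbered from 0, so for 1 <= j <= p - 1 the j-th entry of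
   q^{-max} = (q(2), ..., q(p)) is q 0 j.  When q 0 j = 0 the term is
   0 * _ = 0, which is the intended limiting value; the terms are nonnegative,
   so the default value 0 does not affect the maximum. *)
Definition psi (R : realType) (n p : nat) (q : 'rV[R]_p) : R :=
  \big[Num.max/0]_(j < p | (1 <= j)%N)
     (n%:R * q 0 j * hinv (ln (expR 1 * j%:R) / (n%:R * q 0 j))).

(* Main.v *)
Require Import Defs.
From HB Require Import structures.
From mathcomp Require Import all_boot all_order all_algebra.
From mathcomp Require Import all_classical all_reals all_analysis.
From mathcomp Require Import ring lra.
Import Order.TTheory GRing.Theory Num.Theory.
Import numFieldNormedType.Exports.
Local Open Scope ring_scope.

(** Write P_0 for the null law and a = 1 - eta.  Every alternative used is a
    contamination (1 - s) q_0 + s e_j of the null by a point mass: each of the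
    n draws is replaced, with probability s, by the category j.  It lies at
    distance at least s (1 - q_0(j)) from q_0.  The multinomial law is the
    image of the law of n independent draws (multinomial_pmf_draws), so it is
    enough to test from the draws, where likelihood ratios are products and
    expectations factor (sum_draws_prod).

    If L is a lower bound on the likelihood ratio of a uniform mixture of
    alternatives, then the risk of any test is at least the P_0-mean of
    min(1, L) (minimax_risk_ge), and this mean is at least 1 - a as soon as L
    has P_0-mean at least 1 - a^2/2 and P_0-second moment at most 1 + a^2
    (expect_min1_ge).

    It remains to treat separately the largest of the three terms of the
    separation rate, which costs a factor 3 in c.

    - 1/n (risk_parametric).  With s = a/n, no draw at all is replaced with
      probability (1 - s)^n >= 1 - a, hence L = (1 - s)^n already works; j is
      any category with q_0(j) <= 1/2.

    - The square root (risk_variance).  With j the most likely category the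
      full likelihood ratio has second moment
      (1 + s^2 (1 - q_0(j)) / q_0(j))^n <= exp(a^2/4).

    - psi/n (risk_sparse).  Let J be the index attaining psi, r = q_0(J + 1),
      u = h^{-1}(log(eJ) / (nr)), and mix the alternatives j = 2, ..., J + 1
      with s a small multiple of r u.  Expand the likelihood ratio over the
      random set S of replaced draws and keep only the sets with at most A
      elements, where A is of order n s: by Markov's inequality this loses
      little mass.  In the second moment, pairs j <> k contribute at most 1,
      and, summing out one of the two sets, a diagonal pair contributes at most
      (1 + s/r)^A (mean_truncated_ratioM_le).  Since u log(1 + u) <= 4 h(u)
      (xln_le_hfun), A log(1 + s/r) is at most a small multiple k of
      n r h(u) = log(eJ), and by convexity of exp,
      ((eJ)^k - 1) / J <= k e, which is small uniformly in J.  The truncation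
      is what makes the same computation valid in the Poisson regime, where
      n r is small compared with log(eJ) and the full likelihood ratio has a
      huge second moment. *)

(** * The multinomial law as a law of independent draws *)

Section Sequences.
Variable p : nat.

(** The multinomial coefficient counts the words with given letter counts. By
    induction: removing a first letter j lowers the count x_j by one, and
    (n+1)! = sum_j x_j n!. *)
Lemma card_tuple_counts (n : nat) (x : 'I_p -> nat) :
  (\sum_j x j = n)%N ->
  (#|[set t : n.-tuple 'I_p | [forall j, count_mem j t == x j]]|
     * \prod_j (x j)`! = n`!)%N.
Proof.
elim: n x => [|n IHn] x sx.
  have x0 j : x j = 0%N.
    by apply/eqP; rewrite -leqn0 -sx (bigD1 j) //= leq_addr.
  rewrite big1 ?muln1; last by move=> j _; rewrite x0.
  rewrite (_ : [set _ | _] = [set: 0.-tuple 'I_p]); last first.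
    by apply/setP=> t; rewrite !inE tuple0 /=; apply/forallP=> j; rewrite x0.
  by rewrite cardsT card_tuple.
pose D (t : n.+1.-tuple 'I_p) := [forall j, count_mem j t == x j].
have -> : #|[set t | D t]| = (\sum_(j : 'I_p)
    #|[set t : n.-tuple 'I_p | D [tuple of j :: t]]|)%N.
  rewrite -sum1_card (partition_big (fun t => thead t) xpredT) //=.
  apply: eq_bigr => j _; rewrite -sum1_card.
  rewrite (reindex_onto (fun t : n.-tuple 'I_p => [tuple of j :: t])
    (fun t => [tuple of behead t])) /=.
    apply: eq_bigl => t; rewrite !inE theadE eqxx andbT.
    by rewrite (_ : _ == t) ?andbT //; apply/eqP/val_inj.
  by move=> t /andP[_ /eqP <-]; rewrite -tuple_eta.
rewrite big_distrl /= [RHS](_ : _ = \sum_j x j * n`!)%N; last first.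
  by rewrite factS -sx big_distrl.
apply: eq_bigr => j _; case xj: (x j) => [|m].
  rewrite mul0n (_ : [set _ | _] = finset.set0) ?cards0 ?mul0n //.
  by apply/setP=> t; rewrite !inE; apply/forallP => /(_ j); rewrite /= eqxx xj.
pose x' i := (x i - (j == i))%N.
have xE i : x i = ((j == i) + x' i)%N.
  rewrite /x' subnKC //; case: eqP => // <-; rewrite xj //.
rewrite -(IHn x'); last first.
  apply: succn_inj; rewrite -sx; symmetry.
  transitivity (\sum_i ((j == i) + x' i))%N; first by apply: eq_bigr.
  rewrite big_split /= (bigD1 j) //= eqxx big1 // => i /negPf.
  by rewrite eq_sym => ->.
rewrite (_ : [set t : n.-tuple 'I_p | D [tuple of j :: t]] =
   [set t : n.-tuple 'I_p | [forall j, count_mem j t == x' j]]); last first.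
  by apply/setP=> t; rewrite !inE; apply: eq_forallb => i; rewrite /= xE eqn_add2l.
rewrite mulnCA; congr (_ * _)%N.
rewrite (bigD1 j) //= [in RHS](bigD1 j) //= mulnA /x' eqxx xj subn1 /= factS.
congr (_ * _)%N; apply: eq_bigr => i /negPf ij.
by rewrite eq_sym ij subn0.
Qed.

Lemma card_ffun_counts (n : nat) (x : 'I_p -> nat) :
  (\sum_j x j = n)%N ->
  (#|[set y : {ffun 'I_n -> 'I_p} | [forall j, #|y @^-1: [set j]| == x j]]|
     * \prod_j (x j)`! = n`!)%N.
Proof.
move=> /card_tuple_counts <-; congr (_ * _)%N.
pose f (y : {ffun 'I_n -> 'I_p}) := [tuple y i | i < n].
have f_inj : injective f.
  move=> y z /(congr1 (fun t => tnth t)) e; apply/ffunP=> i.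
  by move: (congr1 (fun g => g i) e); rewrite !tnth_mktuple.
rewrite -(card_imset _ f_inj); apply: eq_card => t; rewrite inE.
have cE y j : count_mem j (f y) = #|y @^-1: [set j]|.
  rewrite count_map cardE /enum_mem size_filter -enumT.
  by apply: eq_count => i; rewrite !inE /=.
apply/imsetP/idP => [[y + ->]|tP].
  by rewrite inE => /forallP yP; apply/forallP => j; rewrite cE.
have tf : t = f [ffun i => tnth t i].
  by apply/eq_from_tnth => i; rewrite tnth_mktuple ffunE.
exists [ffun i => tnth t i] => //; rewrite inE; apply/forallP=> j.
by rewrite -cE -tf; exact: (forallP tP).
Qed.

Lemma card_ord_range J : (J < p)%N -> #|[set i : 'I_p | (1 <= i <= J)%N]| = J.
Proof.
move=> Jp; rewrite -sum1_card.
rewrite (eq_bigl (fun i : 'I_p => (i < J.+1) && (1 <= i))%N); last first.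
  by move=> i; rewrite inE andbC ltnS.
transitivity (\sum_(1 <= i < p | true && (i < J.+1)%N) 1)%N.
  by rewrite big_geq_mkord.
by rewrite -big_nat_widen // sum_nat_const_nat subn1 muln1.
Qed.

End Sequences.

Section Draws.
Context {R : realType} {n p : nat}.
Implicit Types (q : 'rV[R]_p) (y : {ffun 'I_n -> 'I_p}).

Definition draws_pmf q y : R := \prod_i q 0 (y i).

Definition counts y : sample n p := [ffun j => inord #|y @^-1: [set j]|].

Lemma countsE y j : counts y j = #|y @^-1: [set j]| :> nat.
Proof.
rewrite ffunE inordK // ltnS -[X in (_ <= X)%N]card_ord; exact: max_card.
Qed.

Lemma sum_counts y : (\sum_j counts y j = n)%N.
Proof.
under eq_bigr do rewrite countsE -sum1_card.
rewrite -[RHS]card_ord -sum1_card (partition_big y xpredT) //=.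
by apply: eq_bigr => j _; apply: eq_bigl => i; rewrite !inE.
Qed.

Lemma draws_pmf_counts q y : draws_pmf q y = \prod_j q 0 j ^+ counts y j.
Proof.
rewrite /draws_pmf (partition_big y xpredT) //=; apply: eq_bigr => j _.
rewrite countsE -prodr_const; apply: eq_big => i; first by rewrite !inE.
by move=> /eqP ->.
Qed.

Lemma multinomial_pmf_draws q (x : sample n p) :
  multinomial_pmf q x = \sum_(y | counts y == x) draws_pmf q y.
Proof.
rewrite /multinomial_pmf; case: ifPn => [/eqP sx|/eqP sx]; last first.
  by rewrite big_pred0 // => y; apply/eqP => yx; apply: sx; rewrite -yx sum_counts.
rewrite [RHS](eq_bigr (fun=> \prod_j q 0 j ^+ x j)); last first.
  by move=> y /eqP <-; exact: draws_pmf_counts.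
rewrite sumr_const -[RHS]mulr_natl; congr (_ * _).
have fact_neq0 : \prod_(j < p) (x j)`!%:R != 0 :> R.
  by apply/prodf_neq0 => j _; rewrite pnatr_eq0 -lt0n fact_gt0.
apply/(mulIf fact_neq0); rewrite divfK // -natr_prod -natrM.
rewrite -(card_ffun_counts _ _ _ sx); congr ((_ * _)%:R); apply: eq_card => y.
rewrite inE [RHS](_ : _ = (counts y == x)) //.
apply/forallP/eqP => [yx|<- j]; last by rewrite countsE.
by apply/ffunP => j; apply/val_inj; rewrite /= countsE; exact/eqP/yx.
Qed.

(** Independence of the draws. *)
Lemma sum_draws_prod q (F : 'I_n -> 'I_p -> R) :
  \sum_y draws_pmf q y * \prod_i F i (y i) = \prod_i \sum_a q 0 a * F i a.
Proof.
rewrite bigA_distr_bigA; apply: eq_bigr => y _.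
by rewrite -big_split.
Qed.

End Draws.

(** * Lower bounds on the testing risk *)

Section Risk.
Context {R : realType} {n p : nat}.
Implicit Types (q : 'rV[R]_p) (y : {ffun 'I_n -> 'I_p}).

Lemma multinomial_law_draws q (A : {set sample n p}) :
  multinomial_law q A = \sum_(y | counts y \in A) draws_pmf q y.
Proof.
rewrite [RHS](partition_big (fun y => counts y) [in A]) //=.
apply: eq_bigr => x xA; rewrite multinomial_pmf_draws.
by apply: eq_bigl => y; case: eqP => [->|]; rewrite ?andbF // xA.
Qed.

Lemma draws_pmf_ge0 q y : simplex q -> 0 <= draws_pmf q y.
Proof. by move=> [q01 _]; apply: prodr_ge0 => i _; case/andP: (q01 (y i)). Qed.

Lemma sum_draws q : simplex q ->
  \sum_(y : {ffun 'I_n -> 'I_p}) draws_pmf q y = 1 :> R.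
Proof.
move=> [_ q1]; transitivity (\prod_(i < n) \sum_a q 0 a * 1).
  by rewrite -sum_draws_prod; apply: eq_bigr => y _; rewrite big1 ?mulr1.
by rewrite big1 // => i _; rewrite -mulr_suml q1 mulr1.
Qed.

(** Le Cam's method: the supremum over the alternatives dominates the average
    over any finite family of them, and f + (1 - f) L >= min(1, L) for a test
    f.  The bound L may be smaller than the likelihood ratio of the mixture,
    which leaves room for a truncation. *)
Lemma minimax_risk_ge q0 eps (B : {set 'I_p}) (Q : 'I_p -> 'rV[R]_p)
    (L : {ffun 'I_n -> 'I_p} -> R) :
  simplex q0 -> (0 < #|B|)%N ->
  (forall j, j \in B -> alternatives q0 eps (Q j)) ->
  (forall y, draws_pmf q0 y * L y <=
     #|B|%:R^-1 * \sum_(j in B) draws_pmf (Q j) y) ->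
  \sum_y draws_pmf q0 y * Num.min 1 (L y) <= minimax_risk eps n q0.
Proof.
move=> q0s B0 QB LQ; apply: lb_le_inf.
  by exists (test_risk eps q0 (xpredT : sample n p -> bool)), xpredT.
move=> _ [phi _ <-]; rewrite /test_risk; set S := [set _ | _ in _]%classic.
have law01 q (A : {set sample n p}) : simplex q -> multinomial_law q A <= 1.
  move=> qs; rewrite multinomial_law_draws -(sum_draws q qs).
  by rewrite [leRHS](bigID (fun y => counts y \in A)) /= lerDl sumr_ge0 // => y _;
     exact: draws_pmf_ge0.
have leS j : j \in B ->
    multinomial_law (Q j) [set x | ~~ phi x]%SET <= sup S.
  move=> jB; apply: ub_le_sup; last by exists (Q j) => //; exact: QB.
  by exists 1 => _ [q [qs _] <-]; exact: law01.
have BR : 0 < #|B|%:R :> R by rewrite ltr0n.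
have avgS : \sum_(y | ~~ phi (counts y)) draws_pmf q0 y * L y <= sup S.
  apply: (@le_trans _ _ (#|B|%:R^-1 * \sum_(j in B)
      multinomial_law (Q j) [set x | ~~ phi x]%SET)).
    rewrite (eq_bigr (fun j => \sum_(y | ~~ phi (counts y)) draws_pmf (Q j) y)).
      rewrite exchange_big /= mulr_sumr; apply: ler_sum => y _; exact: LQ.
    move=> j _; rewrite multinomial_law_draws; apply: eq_bigl => y.
    by rewrite inE.
  rewrite ler_pdivrMl // mulr_natl -sumr_const; exact: ler_sum.
apply: le_trans (lerD (lexx _) avgS); rewrite multinomial_law_draws.
rewrite [leLHS](bigID (fun y => phi (counts y))) /=; apply: lerD.
  rewrite [leRHS](eq_bigl (fun y => phi (counts y))); last first.
    by move=> y; rewrite inE.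
  apply: ler_sum => y _; rewrite ler_piMr ?draws_pmf_ge0 //.
  by rewrite ge_min lexx.
apply: ler_sum => y _; rewrite ler_wpM2l ?draws_pmf_ge0 //.
by rewrite ge_min lexx orbT.
Qed.

(** The mean of min(1, L) is bounded through a quadratic minorant of
    min(1, t), so that only the first two moments of L enter. *)
Lemma expect_min1_ge q0 (a : R) (L : {ffun 'I_n -> 'I_p} -> R) :
  simplex q0 -> 0 < a <= 1 ->
  1 - a ^+ 2 / 2 <= \sum_y draws_pmf q0 y * L y ->
  \sum_y draws_pmf q0 y * L y ^+ 2 <= 1 + a ^+ 2 ->
  1 - a <= \sum_y draws_pmf q0 y * Num.min 1 (L y).
Proof.
move=> q0s /andP[a0 a1] m1 m2.
have minE (t : R) :
    (1 + t) / 2 - a / 4 - (1 - 2 * t + t ^+ 2) / (4 * a) <= Num.min 1 t.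
  (* min(1, t) = (1 + t - |t - 1|) / 2 and |t - 1| <= (a + (t - 1)^2 / a) / 2 *)
  have a40 : 0 < 4 * a by rewrite mulr_gt0.
  have sq1 : (t - 1 + a) ^+ 2 / (4 * a) >= 0 by rewrite divr_ge0 ?sqr_ge0 ?ltW.
  have sq2 : (1 - t + a) ^+ 2 / (4 * a) >= 0 by rewrite divr_ge0 ?sqr_ge0 ?ltW.
  rewrite le_min; apply/andP; split; rewrite -subr_ge0.
    by rewrite (_ : _ - _ = (1 - t + a) ^+ 2 / (4 * a)) //; field; rewrite gt_eqF.
  by rewrite (_ : _ - _ = (t - 1 + a) ^+ 2 / (4 * a)) //; field; rewrite gt_eqF.
apply: (@le_trans _ _ (\sum_y draws_pmf q0 y *
    ((1 + L y) / 2 - a / 4 - (1 - 2 * L y + L y ^+ 2) / (4 * a)))); last first.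
  by apply: ler_sum => y _; rewrite ler_wpM2l ?draws_pmf_ge0.
pose M := \sum_y draws_pmf q0 y * L y.
pose V := \sum_y draws_pmf q0 y * L y ^+ 2.
rewrite (_ : \sum_y _ = (1 + M) / 2 - a / 4 - (1 - 2 * M + V) / (4 * a)).
  have : (1 - 2 * M + V) / (4 * a) <= a / 2.
    rewrite ler_pdivrMr ?mulr_gt0 //; rewrite -/M -/V in m1 m2; nra.
  rewrite -/M -/V in m1 m2; nra.
transitivity (\sum_y ((1 / 2 - a / 4 - 1 / (4 * a)) * draws_pmf q0 y
   + (1 / 2 + 1 / (2 * a)) * (draws_pmf q0 y * L y)
   - 1 / (4 * a) * (draws_pmf q0 y * L y ^+ 2))).
  by apply: eq_bigr => y _; field; rewrite gt_eqF.
rewrite sumrB big_split /= -!mulr_sumr sum_draws // -/M -/V.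
by field; rewrite gt_eqF.
Qed.

End Risk.

(** * The random set of replaced draws *)

Section RandomSubset.
Context {R : realType} {n : nat}.
Implicit Types (s : R) (S : {set 'I_n}).

Definition subset_pmf s S : R := \prod_i (if i \in S then s else 1 - s).

Lemma subset_pmf_ge0 s S : 0 <= s <= 1 -> 0 <= subset_pmf s S.
Proof.
by move=> /andP[s0 s1]; apply: prodr_ge0 => i _; case: ifP; rewrite ?subr_ge0.
Qed.

Lemma sum_subset_pmf s : \sum_S subset_pmf s S = 1.
Proof.
transitivity (\prod_(i < n) (s + (1 - s))); first by rewrite bigA_distr.
by rewrite big1 // => i _; rewrite subrKC.
Qed.

(** By linearity: the indicator that i is in S replaces by 0 the factor 1 - s of
    the draw i, whose two factors then add up to s instead of 1. *)
Lemma mean_card_subset s : \sum_S subset_pmf s S * #|S|%:R = n%:R * s.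
Proof.
transitivity (\sum_(S : {set 'I_n}) \sum_(i < n) \prod_(k < n)
    (if k \in S then s else (k != i)%:R * (1 - s))).
  apply: eq_bigr => S _; rewrite -sum1_card natr_sum mulr_sumr big_mkcond /=.
  apply: eq_bigr => i _; case: ifP => [iS|/negbT iS].
    rewrite mulr1; apply: eq_bigr => k _; case: ifPn => // kS.
    by rewrite (_ : k != i) ?mul1r //; apply: contraNneq kS => ->.
  by rewrite (bigD1 i) //= (negPf iS) eqxx mul0r mul0r.
rewrite exchange_big /= -[n in RHS]card_ord -sum1_card natr_sum mulr_suml.
apply: eq_bigr => i _; rewrite -bigA_distr mul1r (bigD1 i) //= eqxx mul0r addr0.
by rewrite big1 ?mulr1 // => k ki; rewrite ki mul1r subrKC.
Qed.

Lemma subset_pmf_markov s A : 0 <= s <= 1 ->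
  1 - n%:R * s / A.+1%:R <= \sum_(S : {set 'I_n} | (#|S| <= A)%N) subset_pmf s S.
Proof.
move=> s01; rewrite -[X in X - _](sum_subset_pmf s).
rewrite [X in X - _](bigID (fun S : {set 'I_n} => #|S| <= A)%N) /=.
rewrite -addrA gerDl subr_le0 ler_pdivlMr ?ltr0n // -mean_card_subset.
rewrite [leRHS](bigID (fun S : {set 'I_n} => #|S| <= A)%N) /= mulr_suml.
rewrite -[leLHS]add0r; apply: lerD.
  by apply: sumr_ge0 => S _; rewrite mulr_ge0 ?subset_pmf_ge0.
apply: ler_sum => S; rewrite -ltnNge => AS.
by rewrite ler_wpM2l ?subset_pmf_ge0 // ler_nat.
Qed.

Lemma prod_subset_scale s c S :
  \prod_i (if i \in S then s * c else 1 - s) = subset_pmf s S * c ^+ #|S|.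
Proof.
rewrite -prodr_const [\prod_(i in S) c]big_mkcond -big_split /=.
by apply: eq_bigr => i _; case: ifP; rewrite ?mulr1.
Qed.

End RandomSubset.

(** * Contaminated null distributions *)

Section Contamination.
Context {R : realType} {p : nat}.
Implicit Types (q : 'rV[R]_p) (s : R) (j k a : 'I_p).

Definition contaminate q s j : 'rV[R]_p := (1 - s) *: q + s *: delta_mx 0 j.

Lemma contaminateE q s j a :
  contaminate q s j 0 a = (1 - s) * q 0 a + s * (a == j)%:R.
Proof. by rewrite !mxE eqxx. Qed.

Lemma contaminate_simplex q s j :
  simplex q -> 0 <= s <= 1 -> simplex (contaminate q s j).
Proof.
move=> [q01 q1] /andP[s0 s1]; split=> [a|]; last first.
  under eq_bigr do rewrite contaminateE.
  rewrite big_split /= -mulr_sumr q1 -mulr_sumr (bigD1 j) //= eqxx big1.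
    by rewrite addr0 !mulr1 subrK.
  by move=> a /negPf ->.
have /andP[a0 a1] := q01 a; rewrite contaminateE.
by case: (a == j) => /=; apply/andP; split; nra.
Qed.

Lemma contaminate_dist q s j :
  0 <= s -> q 0 j <= 1 -> s * (1 - q 0 j) <= `|contaminate q s j - q|.
Proof.
move=> s0 qj1; rewrite [leRHS]mx_normrE; apply: le_trans (le_bigmax _ _ (0, j)).
rewrite /= (_ : (contaminate q s j - q) 0 j = s * (1 - q 0 j)) ?ler_norm //.
by rewrite !mxE !eqxx /=; ring.
Qed.

Lemma contaminate_alternative q s j eps :
  simplex q -> 0 <= s <= 1 -> eps <= s * (1 - q 0 j) ->
  alternatives q eps (contaminate q s j).
Proof.
move=> qs s01 es; split; first exact: contaminate_simplex.
have [s0 _] := andP s01; have [/(_ j)/andP[_ qj1] _] := qs.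
by apply: le_trans es _; exact: contaminate_dist.
Qed.

(** The likelihood ratio, for one draw, of the point mass at j. *)
Definition hit q j a : R := (a == j)%:R / q 0 j.

Definition lratio q s j a : R := s * hit q j a + (1 - s).

Lemma hit_ge0 q j a : simplex q -> 0 <= hit q j a.
Proof. by move=> [/(_ j)/andP[q0 _] _]; rewrite divr_ge0. Qed.

Lemma mean_hit q j (F : 'I_p -> R) : 0 < q 0 j ->
  \sum_a q 0 a * (hit q j a * F a) = F j.
Proof.
move=> qj0; rewrite (bigD1 j) //= big1 ?addr0 => [|a /negPf aj].
  by rewrite /hit eqxx mulrA mulrCA mul1r divff ?gt_eqF // mul1r.
by rewrite /hit aj !mul0r mulr0.
Qed.

Lemma mean_lratio q s j : simplex q -> 0 < q 0 j ->
  \sum_a q 0 a * lratio q s j a = 1.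
Proof.
move=> [_ q1] qj0.
rewrite (eq_bigr (fun a => s * (q 0 a * (hit q j a * 1)) + (1 - s) * q 0 a)).
  by rewrite big_split /= -!mulr_sumr mean_hit // q1 !mulr1 subrKC.
by move=> a _; rewrite /lratio; ring.
Qed.

End Contamination.

(** * The truncated likelihood ratio *)

Section TruncatedRatio.
Context {R : realType} {n p : nat}.
Variables (q : 'rV[R]_p) (s : R).
Hypotheses (qs : simplex q) (s01 : 0 <= s <= 1).
Implicit Types (y : {ffun 'I_n -> 'I_p}) (j k : 'I_p) (A : nat).

Lemma draws_contaminate j y : 0 < q 0 j ->
  draws_pmf (contaminate q s j) y = draws_pmf q y * \prod_i lratio q s j (y i).
Proof.
move=> qj0; rewrite /draws_pmf -big_split /=; apply: eq_bigr => i _.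
rewrite contaminateE /lratio /hit mulrDr addrC [(1 - s) * _]mulrC; congr (_ + _).
case: eqP => [->|_]; last by rewrite mul0r !mulr0.
by rewrite mul1r mulrCA divff ?gt_eqF.
Qed.

(** The event that no draw is replaced. *)
Lemma draws_contaminate_ge j y :
  (1 - s) ^+ n * draws_pmf q y <= draws_pmf (contaminate q s j) y.
Proof.
have [s0 s1] := andP s01; have [q01 _] := qs.
rewrite (_ : _ ^+ n = \prod_(i < n) (1 - s)); last by rewrite prodr_const card_ord.
rewrite /draws_pmf -big_split /=; apply: ler_prod => i _.
have /andP[a0 _] := q01 (y i).
by rewrite mulr_ge0 ?subr_ge0 //= contaminateE lerDl mulr_ge0.
Qed.

(** The expansion of the product of the s * hit + (1 - s) over the set S of
    replaced draws, restricted to small S. *)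
Definition truncated_ratio A j y : R :=
  \sum_(S : {set 'I_n} | (#|S| <= A)%N)
    \prod_i (if i \in S then s * hit q j (y i) else 1 - s).

Lemma truncated_ratio_term_ge0 j y (S : {set 'I_n}) :
  0 <= \prod_i (if i \in S then s * hit q j (y i) else 1 - s).
Proof.
have [s0 s1] := andP s01; apply: prodr_ge0 => i _.
by case: ifP => _; rewrite ?subr_ge0 // mulr_ge0 ?hit_ge0.
Qed.

Lemma truncated_ratio_ge0 A j y : 0 <= truncated_ratio A j y.
Proof. by apply: sumr_ge0 => S _; exact: truncated_ratio_term_ge0. Qed.

Lemma truncated_ratio_le A j y :
  truncated_ratio A j y <= \prod_i lratio q s j (y i).
Proof.
rewrite bigA_distr /= [leRHS](bigID (fun S : {set 'I_n} => #|S| <= A)%N) /=.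
by rewrite lerDl; apply: sumr_ge0 => S _; exact: truncated_ratio_term_ge0.
Qed.

Lemma mean_truncated_ratio A j : 0 < q 0 j ->
  \sum_y draws_pmf q y * truncated_ratio A j y =
  \sum_(S : {set 'I_n} | (#|S| <= A)%N) subset_pmf s S.
Proof.
move=> qj0; under eq_bigr do rewrite mulr_sumr.
rewrite exchange_big; apply: eq_bigr => S _ /=.
rewrite (sum_draws_prod q (fun i a => if i \in S then s * hit q j a else 1 - s)).
have [_ q1] := qs; apply: eq_bigr => i _; case: ifP => _; last first.
  by rewrite -mulr_suml q1 mul1r.
rewrite (eq_bigr (fun a => s * (q 0 a * (hit q j a * 1)))).
  by rewrite -mulr_sumr mean_hit // mulr1.
by move=> a _; ring.
Qed.

(** Under the contamination by k, which is the change of measure given by the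
    full ratio, each draw of S equal to j contributes the one-draw ratio
    lratio k at j, and the other draws average to 1. *)
Lemma mean_truncated_ratioM A j k : 0 < q 0 j -> 0 < q 0 k ->
  \sum_y draws_pmf q y *
     (truncated_ratio A j y * \prod_i lratio q s k (y i)) =
  \sum_(S : {set 'I_n} | (#|S| <= A)%N)
     subset_pmf s S * lratio q s k j ^+ #|S|.
Proof.
move=> qj0 qk0; under eq_bigr do rewrite mulr_suml mulr_sumr.
rewrite exchange_big; apply: eq_bigr => S _ /=.
under eq_bigr do rewrite -big_split /=.
rewrite (sum_draws_prod q (fun i a =>
  (if i \in S then s * hit q j a else 1 - s) * lratio q s k a)).
rewrite -prod_subset_scale; apply: eq_bigr => i _; case: ifP => _.
  rewrite (eq_bigr (fun a => s * (q 0 a * (hit q j a * lratio q s k a)))).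
    by rewrite -mulr_sumr mean_hit.
  by move=> a _; ring.
rewrite (eq_bigr (fun a => (1 - s) * (q 0 a * lratio q s k a))).
  by rewrite -mulr_sumr mean_lratio // mulr1.
by move=> a _; ring.
Qed.

Lemma sum_subset_pmf_le1 A :
  \sum_(S : {set 'I_n} | (#|S| <= A)%N) subset_pmf s S <= 1.
Proof.
rewrite -(sum_subset_pmf (n := n) s).
rewrite [leRHS](bigID (fun S : {set 'I_n} => #|S| <= A)%N) /=.
by rewrite lerDl; apply: sumr_ge0 => S _; exact: subset_pmf_ge0.
Qed.

(** For j <> k the one-draw ratio at j is 1 - s <= 1: the alternatives are
    negatively correlated.  For j = k it is 1 - s + s / q_j, raised to a power
    which the truncation keeps at most A. *)
Lemma mean_truncated_ratioM_le A j k (r : R) : 0 < r ->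
  r <= q 0 j -> r <= q 0 k ->
  \sum_y draws_pmf q y *
     (truncated_ratio A j y * \prod_i lratio q s k (y i)) <=
  1 + (j == k)%:R * ((1 + s / r) ^+ A - 1).
Proof.
move=> r0 rj rk; have [s0 s1] := andP s01.
have qj0 := lt_le_trans r0 rj; have qk0 := lt_le_trans r0 rk.
have sr0 : 0 <= s / r by rewrite divr_ge0 // ltW.
rewrite mean_truncated_ratioM // /lratio /hit; case: eqP => [_|_].
  rewrite /= !mul1r subrKC.
  apply: (@le_trans _ _ (\sum_(S : {set 'I_n} | (#|S| <= A)%N)
      subset_pmf s S * (1 + s / r) ^+ A)).
    apply: ler_sum => S SA; rewrite ler_wpM2l ?subset_pmf_ge0 //.
    have k0 : s / q 0 k <= s / r by rewrite ler_wpM2l // lef_pV2.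
    have k1 : 0 <= s / q 0 k by rewrite divr_ge0 // ltW.
    apply: (@le_trans _ _ ((1 + s / r) ^+ #|S|)).
      by apply: lerXn2r; rewrite ?nnegrE; lra.
    by apply: ler_weXn2l => //; lra.
  rewrite -mulr_suml ler_piMl ?sum_subset_pmf_le1 // exprn_ge0 //; lra.
rewrite /= !mul0r addr0 mulr0 add0r.
apply: le_trans (sum_subset_pmf_le1 A); apply: ler_sum => S _.
by rewrite ler_piMr ?subset_pmf_ge0 // exprn_ile1 //; lra.
Qed.

Definition mixture_ratio A (B : {set 'I_p}) y : R :=
  #|B|%:R^-1 * \sum_(j in B) truncated_ratio A j y.

Lemma mean_mixture_ratio A (B : {set 'I_p}) : (0 < #|B|)%N ->
  (forall j, j \in B -> 0 < q 0 j) ->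
  1 - n%:R * s / A.+1%:R <= \sum_y draws_pmf q y * mixture_ratio A B y.
Proof.
move=> B0 qB; apply: le_trans (subset_pmf_markov _ A s01) _.
rewrite (eq_bigr (fun y => #|B|%:R^-1 *
    \sum_(j in B) draws_pmf q y * truncated_ratio A j y)); last first.
  by move=> y _; rewrite mulrCA mulr_sumr.
rewrite -mulr_sumr exchange_big /= (eq_bigr _ (fun j jB =>
  mean_truncated_ratio A j (qB j jB))) sumr_const.
rewrite -[X in _ <= _ * X]mulr_natl mulKf //.
by rewrite pnatr_eq0 -lt0n.
Qed.

(** One of the two truncated factors of the square is bounded by the full
    ratio, which makes its random set sum out exactly. *)
Lemma second_moment_mixture_ratio A (B : {set 'I_p}) (r : R) : (0 < #|B|)%N ->
  0 < r -> (forall j, j \in B -> r <= q 0 j) ->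
  \sum_y draws_pmf q y * mixture_ratio A B y ^+ 2 <=
  1 + ((1 + s / r) ^+ A - 1) / #|B|%:R.
Proof.
move=> B0 r0 rB; set b : R := #|B|%:R.
have b0 : 0 < b by rewrite ltr0n.
have b2 : 0 <= b ^- 2 by rewrite invr_ge0 exprn_ge0 ?ltW.
apply: (@le_trans _ _ (b ^- 2 * \sum_(j in B) \sum_(k in B)
    \sum_y draws_pmf q y *
     (truncated_ratio A j y * \prod_i lratio q s k (y i)))).
  under [X in _ <= _ * X]eq_bigr do rewrite exchange_big /=.
  rewrite exchange_big /= mulr_sumr; apply: ler_sum => y _.
  rewrite (_ : \sum_(j in B) _ = draws_pmf q y *
      ((\sum_(j in B) truncated_ratio A j y) *
       \sum_(k in B) \prod_i lratio q s k (y i))); last first.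
    rewrite mulr_suml mulr_sumr; apply: eq_bigr => j _.
    by rewrite !mulr_sumr.
  rewrite [leRHS]mulrCA ler_wpM2l ?draws_pmf_ge0 //.
  rewrite /mixture_ratio -/b exprMn exprVn ler_wpM2l //.
  rewrite expr2 ler_wpM2l //.
    by apply: sumr_ge0 => j _; exact: truncated_ratio_ge0.
  by apply: ler_sum => k _; exact: truncated_ratio_le.
set D := (_ ^+ A - 1).
apply: (@le_trans _ _ (b ^- 2 * \sum_(j in B) (b + D))).
  rewrite ler_wpM2l //.
  apply: ler_sum => j jB.
  apply: (@le_trans _ _ (\sum_(k in B) (1 + (j == k)%:R * D))).
    apply: ler_sum => k kB; apply: mean_truncated_ratioM_le => //; exact: rB.
  rewrite big_split /= sumr_const lerD2l -mulr_suml (bigD1 j) //= eqxx big1.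
    by rewrite addr0 mul1r.
  by move=> k /andP[_ /negPf]; rewrite eq_sym => ->.
rewrite sumr_const -[X in _ * X <= _]mulr_natl -/b.
by rewrite le_eqVlt; apply/orP; left; apply/eqP; field; rewrite gt_eqF.
Qed.

End TruncatedRatio.

(** * The function h and elementary inequalities *)

Section Elementary.
Context {R : realType}.
Implicit Types (r u x y t k : R).

Lemma ln_le_sub1 x : 0 < x -> ln x <= x - 1.
Proof. by move=> x0; rewrite -{1}[x](subrKC 1) le_ln1Dx // ltrBrDl subrr. Qed.

Lemma hfunE u : 0 <= u -> hfun u = (1 + u) * ln (1 + u) - u.
Proof. by move=> u0; rewrite /hfun ifF //; apply/negbTE/eqP; lra. Qed.

(** Bounding log through the square root keeps the second order of h at 0,
    which log x >= 1 - 1/x alone would lose. *)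
Lemma ln_sqr_ge r : 1 <= r -> 2 * (1 - r^-1) <= ln (r ^+ 2).
Proof.
move=> r1; have r0 : 0 < r by lra.
have := @ln_le_sub1 r^-1; rewrite invr_gt0 => /(_ r0).
rewrite lnV ?posrE // expr2 lnM ?posrE //; lra.
Qed.

Lemma hfun_ge_sqr r : 1 <= r -> (r - 1) ^+ 2 <= hfun (r ^+ 2 - 1).
Proof.
move=> r1; have r0 : 0 < r by lra.
have r21 : 1 <= r ^+ 2 by rewrite expr_ge1 //; lra.
rewrite hfunE ?subr_ge0 // subrKC; have := ln_sqr_ge r r1.
rewrite -(ler_pM2l (exprn_gt0 2 r0)).
rewrite (_ : r ^+ 2 * (_ * _) = 2 * r ^+ 2 - 2 * r); first lra.
by field; rewrite gt_eqF.
Qed.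

(** The left-hand side is h(u) + (u - log(1 + u)), and both terms are of order
    u^2 at 0 while the second is at most u.  With r the square root of 1 + u,
    both are compared with (r - 1)^2. *)
Lemma xln_le_hfun u : 0 <= u -> u * ln (1 + u) <= 4 * hfun u.
Proof.
move=> u0; pose r := Num.sqrt (1 + u).
have r2 : r ^+ 2 = 1 + u by rewrite sqr_sqrtr; lra.
have r1 : 1 <= r by rewrite -sqrtr1 ler_wsqrtr; lra.
have := hfun_ge_sqr r r1; have := ln_sqr_ge r r1.
have -> : r ^+ 2 - 1 = u by lra.
rewrite r2 hfunE // => lnr hr.
have r0 : 0 < r by lra.
(* (1 + u) - 1 - ln (1 + u) <= (r - 1)^2 (r + 2) / r <= 3 (r - 1)^2 *)
have : r ^+ 2 - 1 - 2 * (1 - r^-1) <= 3 * (r - 1) ^+ 2.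
  rewrite -subr_ge0 (_ : _ - _ = 2 * (r - 1) ^+ 3 / r).
    by rewrite divr_ge0 ?mulr_ge0 ?exprn_ge0; lra.
  by field; rewrite gt_eqF.
lra.
Qed.

Lemma hfun_surj y : 0 <= y -> exists2 u, 0 <= u & hfun u = y.
Proof.
move=> y0; pose r := 1 + Num.sqrt y; pose b := r ^+ 2 - 1.
have sy0 : 0 <= Num.sqrt y by exact: sqrtr_ge0.
have r1 : 1 <= r by rewrite /r; lra.
have b0 : 0 <= b by rewrite subr_ge0 expr_ge1 //; lra.
have yb : y <= hfun b.
  apply: le_trans (hfun_ge_sqr r r1).
  by rewrite /r [1 + _]addrC addrK sqr_sqrtr.
pose g u := (1 + u) * ln (1 + u) - u.
have gc : {within `[0, b], continuous g}%classic.
  apply: continuous_in_subspaceT => u /set_mem /=; rewrite in_itv /= => /andP[u0 _].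
  have c1 : {for u, continuous (fun u : R => 1 + u)}.
    by apply: cvgD; [exact: cvg_cst|exact: cvg_id].
  apply: cvgB; last exact: cvg_id.
  apply: cvgM; first exact: c1.
  by apply: (continuous_comp c1); apply: continuous_ln; lra.
have g0 : g 0 = 0 by rewrite /g addr0 ln1 mulr0 subr0.
have gb : g b = hfun b by rewrite hfunE.
have [|u] := @IVT R g 0 b y b0 gc.
  by rewrite g0 gb ge_min y0 le_max yb orbT.
rewrite in_itv /= => /andP[u0 _] gu; exists u => //; by rewrite hfunE.
Qed.

(** The pseudo-inverse is a right inverse as soon as h maps [0, +oo[ onto
    itself. *)
Lemma hinvK y : 0 <= y -> 0 <= hinv y /\ hfun (hinv y) = y.
Proof.
move=> y0; have S : set_surj `[0, +oo[%classic `[0, +oo[%classic (@hfun R).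
  move=> z /=; rewrite in_itv /= andbT => /hfun_surj[v v0 vz].
  by exists v => //=; rewrite in_itv /= v0.
have yA : y \in `[0, +oo[%classic by rewrite inE /= in_itv /= y0.
split; last exact: (surjpK _ S).
have /(_ point (hinv y)) := surjpinv_image_sub S; rewrite /= in_itv /= andbT.
by apply; exists y => //=; rewrite in_itv /= y0.
Qed.

(** By convexity, exp lies below its chord over [0, t]. *)
Lemma expR_chord k t : 0 <= k <= 1 -> expR (k * t) <= 1 + k * (expR t - 1).
Proof.
move=> /andP[k0 k1]; have := convex_expR (Itv01 k0 k1) t 0.
rewrite !convRE /= mulr0 addr0 expR0 /unstable.onem; lra.
Qed.

Lemma bernoulli_ineq (s : R) (m : nat) : s <= 1 -> 1 - m%:R * s <= (1 - s) ^+ m.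
Proof.
move=> s1; elim: m => [|m IHm]; first by rewrite mul0r subr0 expr0.
rewrite exprS -natr1; have m0 : 0 <= m%:R :> R by [].
have := ler_wpM2l (_ : 0 <= 1 - s) IHm; rewrite subr_ge0 => /(_ s1); nra.
Qed.

Lemma expR2_gt4 : 4 < expR 2 :> R.
Proof.
have e2 : 2 < expR 1 :> R.
  by have := @expR_gt1Dx R 1; rewrite oner_eq0 => /(_ isT); lra.
rewrite (_ : 2 = 1 + 1 :> R); last by [].
rewrite expRD; nra.
Qed.

End Elementary.

(** * The three terms of the separation rate *)

Section Cases.
Context {R : realType} {n p : nat}.
Variables (q : 'rV[R]_p) (a : R).
Hypotheses (n_gt0 : (0 < n)%N) (qs : simplex q) (a01 : 0 < a <= 1).

(** Contaminate by a/n: with probability at least 1 - a no draw is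
    replaced. *)
Lemma risk_parametric eps j : q 0 j <= 1 / 2 -> eps <= a / 2 * (1 / n%:R) ->
  1 - a <= minimax_risk eps n q.
Proof.
move=> qj2 epsE; have [a0 a1] := andP a01.
have nR : 1 <= n%:R :> R by rewrite ler1n.
pose s := a / n%:R.
have s01 : 0 <= s <= 1.
  by rewrite divr_ge0 ?ler_pdivrMr ?mul1r; lra.
have eps_s : eps <= s * (1 - q 0 j).
  apply: le_trans epsE _; rewrite /s; have : 0 <= a / n%:R by case/andP: s01.
  nra.
have B0 : (0 < #|[set j]|)%N by rewrite cards1.
have := @minimax_risk_ge R n p q eps [set j] (contaminate q s)
  (fun=> (1 - s) ^+ n) qs B0.
move=> risk_ge; apply: le_trans (risk_ge _ _); clear risk_ge.
- rewrite -mulr_suml sum_draws // mul1r le_min.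
  apply/andP; split; first lra.
  have /andP[_ s1] := s01; apply: le_trans (bernoulli_ineq s n s1).
  by rewrite /s mulrC divfK // gt_eqF //; lra.
- by move=> _ /set1P ->; exact: contaminate_alternative.
- move=> y; rewrite cards1 invr1 mul1r big_set1 mulrC.
  exact: draws_contaminate_ge.
Qed.

Lemma second_moment_contaminate s j : 0 < q 0 j ->
  \sum_(y : {ffun 'I_n -> 'I_p}) draws_pmf q y *
    (\prod_i lratio q s j (y i)) ^+ 2 =
  (1 + s ^+ 2 * ((1 - q 0 j) / q 0 j)) ^+ n.
Proof.
move=> qj0; under eq_bigr do rewrite -prodrXl.
rewrite (sum_draws_prod q (fun i b => lratio q s j b ^+ 2)).
rewrite prodr_const card_ord; congr (_ ^+ n).
rewrite (eq_bigr (fun b => s * (q 0 b * (hit q j b * lratio q s j b))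
    + (1 - s) * (q 0 b * lratio q s j b))); last first.
  by move=> b _; rewrite /lratio; ring.
rewrite big_split /= -!mulr_sumr mean_hit // mean_lratio //.
by rewrite /lratio /hit eqxx /=; field; rewrite gt_eqF.
Qed.

(** The first hypothesis ensures that the contamination level is at most 1;
    where it fails the parametric rate 1/n dominates. *)
Lemma risk_variance eps j : 1 / n%:R <= q 0 j * (1 - q 0 j) ->
  eps <= a / 2 * Num.sqrt (q 0 j * (1 - q 0 j) / n%:R) ->
  1 - a <= minimax_risk eps n q.
Proof.
set v := q 0 j * (1 - q 0 j) => vn epsE; have [a0 a1] := andP a01.
have nR : 1 <= n%:R :> R by rewrite ler1n.
have n0 : 0 < n%:R :> R by lra.
have [/(_ j)/andP[qj0 qj1] _] := qs.
have v0 : 0 < v by apply: lt_le_trans vn; rewrite divr_gt0.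
have {}qj0 : 0 < q 0 j by rewrite lt_neqAle qj0 andbT; apply: contraTneq v0;
  rewrite /v => <-; rewrite mul0r ltxx.
have {}qj1 : q 0 j < 1 by rewrite lt_neqAle qj1 andbT; apply: contraTneq v0;
  rewrite /v => ->; rewrite subrr mulr0 ltxx.
pose d := a / 2 * Num.sqrt (v / n%:R); pose s := d / (1 - q 0 j).
have d0 : 0 <= d by rewrite mulr_ge0 ?sqrtr_ge0 //; lra.
have d2 : d ^+ 2 = a ^+ 2 / 4 * (v / n%:R).
  rewrite exprMn sqr_sqrtr; last by rewrite divr_ge0 ?ltW.
  by congr (_ * _); field.
have dq : d <= 1 - q 0 j.
  rewrite -(@ler_pXn2r _ 2) ?nnegrE //; last lra.
  rewrite d2; have : v / n%:R <= v * v by rewrite ler_pM2l // -div1r.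
  have : a ^+ 2 <= 1 by rewrite expr_le1 //; lra.
  have : v <= 1 - q 0 j by rewrite /v; nra.
  nra.
have s01 : 0 <= s <= 1.
  by rewrite divr_ge0 ?ler_pdivrMr ?mul1r ?dq; lra.
have eps_s : eps <= s * (1 - q 0 j).
  by rewrite divfK //; rewrite subr_eq0 gt_eqF.
have B0 : (0 < #|[set j]|)%N by rewrite cards1.
have := @minimax_risk_ge R n p q eps [set j] (contaminate q s)
  (fun y => \prod_i lratio q s j (y i)) qs B0.
move=> risk_ge; apply: le_trans (risk_ge _ _); clear risk_ge.
- apply: expect_min1_ge => //.
    under eq_bigr do rewrite -draws_contaminate //.
    rewrite sum_draws; first by rewrite gerBl divr_ge0 ?exprn_ge0; lra.
    exact: contaminate_simplex.
  rewrite second_moment_contaminate //.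
  have -> : s ^+ 2 * ((1 - q 0 j) / q 0 j) = a ^+ 2 / 4 / n%:R.
    rewrite /s expr_div_n d2 /v; field.
    by rewrite !gt_eqF //; lra.
  set x := a ^+ 2 / 4.
  have x0 : 0 <= x by rewrite divr_ge0 ?exprn_ge0; lra.
  have x4 : x <= 1 / 4.
    by have : a ^+ 2 <= 1 by [rewrite expr_le1 //; lra]; rewrite /x; lra.
  apply: (@le_trans _ _ (expR x)).
    rewrite -[x in leRHS](@divfK _ n%:R) ?gt_eqF // expRM_natr.
    apply: lerXn2r; rewrite ?nnegrE ?expR_ge0 ?expR_ge1Dx //.
    by rewrite addr_ge0 // divr_ge0 // ltW.
  have := expR_ge1Dx (- x); have := expRxMexpNx_1 x; have := expR_gt0 x.
  rewrite (_ : a ^+ 2 = 4 * x); last by rewrite /x; field.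
  nra.
- by move=> _ /set1P ->; exact: contaminate_alternative.
- move=> y; rewrite cards1 invr1 mul1r big_set1.
  by rewrite draws_contaminate.
Qed.

(** The mixture runs over the categories 1, ..., j, numbered from 0, which
    all have null probability at least q 0 j. *)
Lemma risk_sparse eps (j : 'I_p) :
  (forall i k : 'I_p, (i <= k)%N -> q 0 k <= q 0 i) ->
  (1 <= j)%N -> 0 < q 0 j ->
  eps <= a ^+ 4 / (16 * expR 2) *
    (q 0 j * hinv (ln (expR 1 * j%:R) / (n%:R * q 0 j))) ->
  1 - a <= minimax_risk eps n q.
Proof.
set r := q 0 j; set l := ln _; set u := hinv _ => q_sorted j1 r0 epsE.
have [a0 a1] := andP a01; have [q01 q1] := qs.
have nR : 1 <= n%:R :> R by rewrite ler1n.
have n0 : 0 < n%:R :> R by lra.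
have jR : 1 <= j%:R :> R by rewrite ler1n.
have e2 := @expR2_gt4 R.
have lE : l = 1 + ln j%:R.
  by rewrite /l lnM ?posrE ?expR_gt0 ?expRK //; lra.
have lj0 : 0 <= ln j%:R :> R by exact: ln_ge0.
have [u0 hu] : 0 <= u /\ hfun u = l / (n%:R * r).
  by apply: hinvK; rewrite divr_ge0 ?mulr_ge0 //; lra.
(* n r h(u) = l and u log(1 + u) <= 4 h(u) *)
have nru : n%:R * r * (u * ln (1 + u)) <= 4 * l.
  have nr0 : 0 < n%:R * r by rewrite mulr_gt0.
  have -> : l = n%:R * r * hfun u by rewrite hu mulrC divfK ?gt_eqF.
  by rewrite [leRHS]mulrCA ler_pM2l // xln_le_hfun.
pose B := [set i : 'I_p | (1 <= i <= j)%N].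
have cB : #|B| = j by exact: card_ord_range.
have B0 : (0 < #|B|)%N by rewrite cB.
have rB i : i \in B -> r <= q 0 i.
  by rewrite inE => /andP[_ ij]; exact: q_sorted.
(* q_i <= q_0 and q_0 + q_i <= 1 *)
have B2 i : i \in B -> q 0 i <= 1 / 2.
  rewrite inE => /andP[i1 _].
  have p0 : (0 < p)%N by apply: leq_ltn_trans (ltn_ord i).
  pose o := Ordinal p0; have qo : q 0 i <= q 0 o by exact: q_sorted.
  have oi : i != o by rewrite -val_eqE /= -lt0n.
  have : q 0 o + q 0 i <= 1.
    rewrite -q1 (bigD1 o) //= lerD2l (bigD1 i) //= lerDl sumr_ge0 // => k _.
    by case/andP: (q01 k).
  lra.
have rj : j%:R * r <= 1.
  rewrite -[leRHS]q1 (bigID [in B]) /= -cB mulr_natl -sumr_const.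
  rewrite -[leLHS]addr0; apply: lerD; first exact: ler_sum.
  by apply: sumr_ge0 => k _; case/andP: (q01 k).
have lnr : ln j%:R <= - ln r.
  rewrite -lnV ?posrE // ler_ln ?posrE ?invr_gt0 //; last lra.
  by rewrite -[leRHS]mul1r ler_pdivlMr.
have lnr0 : ln r <= 0 by lra.
(* Needed for the contamination level to be at most 1: if r u > e^2 then
   log(1 + u) >= 2 - log r, and r u log(1 + u) > 4 (2 - log r) contradicts
   nru, as l <= 1 - log r. *)
have ru : r * u <= expR 2.
  rewrite leNgt; apply/negP => ru.
  have lnu : 2 - ln r <= ln (1 + u).
    rewrite -[2 in leLHS](expRK (R := R)) -ln_div ?posrE ?expR_gt0 //.
    rewrite ler_ln ?posrE ?divr_gt0 ?expR_gt0 //; last lra.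
    by rewrite ler_pdivrMr //; nra.
  have ru4 : 4 * ln (1 + u) < r * u * ln (1 + u).
    by rewrite ltr_pM2r; lra.
  have : r * u * ln (1 + u) <= n%:R * (r * u * ln (1 + u)) by rewrite ler_peMl; lra.
  lra.
pose c := a ^+ 4 / (8 * expR 2); pose s := c * (r * u).
have e0 : 0 < expR 2 :> R by exact: expR_gt0.
have a4 : 0 < a ^+ 4 <= 1 by rewrite exprn_gt0 // expr_le1 // ltW.
have c0 : 0 < c by rewrite divr_gt0 ?mulr_gt0 //; lra.
have ce : c * expR 2 = a ^+ 4 / 8 by rewrite /c; field; rewrite gt_eqF.
have c1 : c <= 1 by nra.
have ru0 : 0 <= r * u by rewrite mulr_ge0 // ltW.
have s0 : 0 <= s by rewrite mulr_ge0 // ltW.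
have s01 : 0 <= s <= 1.
  by rewrite s0 /=; apply: (@le_trans _ _ (c * expR 2)); [rewrite ler_pM2l|lra].
have eps_s i : i \in B -> eps <= s * (1 - q 0 i).
  move=> /B2 qi; apply: le_trans epsE _.
  rewrite (_ : _ * _ = s * (1 / 2)); last by rewrite /s /c; field; rewrite gt_eqF.
  by apply: ler_wpM2l => //; lra.
(* Markov's inequality at A + 1 > n s / delta loses at most the mass delta. *)
pose delta := a ^+ 2 / 2; pose A := Num.trunc (n%:R * s / delta).
have a2 : 0 < a ^+ 2 by rewrite exprn_gt0.
have delta0 : 0 < delta by rewrite divr_gt0.
have ns0 : 0 <= n%:R * s / delta by rewrite divr_ge0 ?mulr_ge0 // ltW.
have [Ale Agt] := andP (truncn_itv ns0).
have := @minimax_risk_ge R n p q eps B (contaminate q s)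
  (mixture_ratio q s A B) qs B0.
move=> risk_ge; apply: le_trans (risk_ge _ _); clear risk_ge.
- apply: expect_min1_ge => //.
    apply: le_trans (mean_mixture_ratio _ _ qs s01 A B B0 _); last first.
      by move=> i iB; exact: lt_le_trans r0 (rB _ iB).
    rewrite lerD2l lerN2 ler_pdivrMr ?ltr0n //.
    by rewrite [leRHS]mulrC -ler_pdivrMr; [exact: ltW|exact: delta0].
  apply: le_trans (second_moment_mixture_ratio _ _ qs s01 A B _ B0 r0 rB) _.
  rewrite cB lerD2l ler_pdivrMr; last lra.
  have sr : 1 + s / r <= 1 + u.
    rewrite lerD2l (_ : s / r = c * u) ?ler_piMl //.
    by rewrite /s; field; rewrite gt_eqF.
  have sr1 : 1 <= 1 + s / r by rewrite lerDl divr_ge0 // ltW.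
  have lnsr : 0 <= ln (1 + s / r) <= ln (1 + u).
    by rewrite ln_ge0 //= ler_ln ?posrE //; lra.
  pose k := a ^+ 2 / expR 2.
  have k01 : 0 <= k <= 1.
    by rewrite divr_ge0 ?ler_pdivrMr //; nra.
  have expo : A%:R * ln (1 + s / r) <= k * l.
    apply: (@le_trans _ _ (n%:R * s / delta * ln (1 + u))).
      by case/andP: lnsr => *; apply: ler_pM.
    rewrite (_ : _ * _ = a ^+ 2 / (4 * expR 2) *
        (n%:R * r * (u * ln (1 + u)))); last first.
      by rewrite /s /c /delta; field; rewrite !gt_eqF.
    rewrite (_ : k * l = a ^+ 2 / (4 * expR 2) * (4 * l)); last first.
      by rewrite /k; field; rewrite gt_eqF.
    by apply: ler_wpM2l => //; rewrite divr_ge0 ?mulr_ge0 // ltW.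
  have -> : (1 + s / r) ^+ A = expR (A%:R * ln (1 + s / r)).
    by rewrite expRM_natl lnK // posrE; lra.
  have el : expR l = expR 1 * j%:R.
    by rewrite /l lnK // posrE mulr_gt0 ?expR_gt0 //; lra.
  have := expR_chord k l k01; rewrite el => chord.
  have : expR (A%:R * ln (1 + s / r)) <= expR (k * l) by rewrite ler_expR.
  have ke : k * expR 1 <= a ^+ 2.
    rewrite /k mulrAC ler_pdivrMr // ler_pM2l // ler_expR; lra.
  have := ler_wpM2r (_ : 0 <= j%:R) ke => /(_ (ler0n _ _)).
  have /andP[k0 _] := k01; lra.
- by move=> i iB; apply: contaminate_alternative => //; exact: eps_s.
- move=> y; rewrite /mixture_ratio mulrCA ler_wpM2l ?invr_ge0 // mulr_sumr.
  apply: ler_sum => i iB; rewrite draws_contaminate //; last first.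
    exact: lt_le_trans r0 (rB _ iB).
  by rewrite ler_wpM2l ?draws_pmf_ge0 // truncated_ratio_le.
Qed.

End Cases.

(** * Combining the three terms *)

Theorem corollary1 (R : realType) (eta : R) (eta_gt0 : 0 < eta)
    (eta_lt1 : eta < 1) :
  exists c : R, 0 < c /\
    forall (n p : nat) (q0 : 'rV[R]_p),
      (1 <= n)%N -> (2 <= p)%N -> simplex q0 ->
      (forall i j : 'I_p, (i <= j)%N -> q0 0 j <= q0 0 i) ->
      eta <= minimax_risk
               (c * (1 / n%:R
                     + Num.sqrt (qmax q0 * (1 - qmax q0) / n%:R)
                     + psi n q0 / n%:R)) n q0.
Proof.
pose a := 1 - eta; have a01 : 0 < a <= 1 by rewrite /a; lra.
have [a0 a1] := andP a01.
have e4 := @expR2_gt4 R.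
have a4 : 0 < a ^+ 4 by rewrite exprn_gt0.
(* The sum of the three terms is at most 3 times the largest one, and 3 c is
   the constant of risk_sparse, the most demanding of the three cases. *)
pose c := a ^+ 4 / (48 * expR 2).
have c3 : 3 * c = a ^+ 4 / (16 * expR 2).
  by rewrite /c; field; rewrite gt_eqF //; lra.
have c0 : 0 < c by rewrite divr_gt0 //; lra.
have ca : 3 * c <= a / 2.
  rewrite c3 ler_pdivrMr; last lra.
  have : a ^+ 4 <= a by rewrite exprS ler_piMr ?expr_le1 //; lra.
  nra.
exists c; split=> // n p q n1 p2 qs q_sorted.
have -> : eta = 1 - a by rewrite /a; lra.
have nR : 1 <= n%:R :> R by rewrite ler1n.
have [q01 q1] := qs.
pose o0 := Ordinal (ltnW p2); pose o1 := Ordinal p2.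
set x1 : R := 1 / n%:R; set x2 : R := Num.sqrt _; set x3 : R := psi n q / n%:R.
have x10 : 0 < x1 by rewrite divr_gt0 //; lra.
have half : q 0 o1 <= 1 / 2.
  have : q 0 o1 <= q 0 o0 by exact: q_sorted.
  have : q 0 o0 + q 0 o1 <= 1.
    rewrite -q1 (bigD1 o0) //= lerD2l (bigD1 o1) //= lerDl sumr_ge0 // => k _.
    by case/andP: (q01 k).
  lra.
have [/andP[x21 x31]|] := boolP ((x2 <= x1) && (x3 <= x1)).
  by apply: (risk_parametric _ _ n1 qs a01 _ _ half); rewrite -/x1; nra.
have [/andP[x12 x32] _|] := boolP ((x1 <= x2) && (x3 <= x2)).
  have [//|i _|j _ qj] := @eq_bigmax _ _ _ 0 o0 xpredT (fun i => q 0 i).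
    by case/andP: (q01 i).
  have {}qj : qmax q = q 0 j by [].
  have v0 : 0 <= qmax q * (1 - qmax q).
    by rewrite qj; have /andP[? ?] := q01 j; rewrite mulr_ge0 ?subr_ge0.
  apply: (risk_variance _ _ n1 qs a01 _ j); rewrite -qj; last by rewrite -/x2; nra.
  have n0 : 0 < n%:R :> R by lra.
  have : x1 ^+ 2 <= x2 ^+ 2 by apply: lerXn2r; rewrite ?nnegrE ?sqrtr_ge0 // ltW.
  rewrite sqr_sqrtr; last by rewrite divr_ge0 // ltW.
  by rewrite /x1 div1r expr2 ler_pM2r ?invr_gt0.
rewrite !negb_and -!ltNge => x2max x1max.
have x31 : x1 < x3 by case/orP: x2max; case/orP: x1max; lra.
have x32 : x2 <= x3 by case/orP: x2max; case/orP: x1max; lra.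
have psi0 : 0 < psi n q.
  by have : 0 < x3 by [lra]; rewrite pmulr_lgt0 // invr_gt0; lra.
have [//|i i1|j j1 psij] := @eq_bigmax _ _ _ 0 o1 (fun i : 'I_p => (1 <= i)%N)
    (fun i => n%:R * q 0 i * hinv (ln (expR 1 * i%:R) / (n%:R * q 0 i))).
  have /andP[qi0 _] := q01 i.
  have i1R : 1 <= i%:R :> R by rewrite ler1n.
  have nq0 : 0 <= n%:R * q 0 i by rewrite mulr_ge0.
  rewrite mulr_ge0 //; apply: (proj1 (hinvK _ _)); rewrite divr_ge0 // ln_ge0 //.
  by have := @expR_ge1Dx R 1; nra.
have {}psij : psi n q =
  n%:R * q 0 j * hinv (ln (expR 1 * j%:R) / (n%:R * q 0 j)) by [].
have qj0 : 0 < q 0 j.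
  have /andP[+ _] := q01 j; rewrite le_eqVlt => /orP[/eqP qj|//].
  by move: psi0; rewrite psij -qj mulr0 mul0r ltxx.
apply: (risk_sparse _ _ n1 qs a01 _ j q_sorted j1 qj0).
set u := hinv _ in psij *; rewrite -c3.
have -> : q 0 j * u = x3.
  by rewrite /x3 psij; field; rewrite gt_eqF //; lra.
nra.
Qed.
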